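(* Let $n \geq 1$, let $H_0 \in \mathbb{C}^{n \times n}$ be Hermitian, let $V=\mathrm{diag}(v_1,\dots,v_n) \in \mathbb{R}^{n \times n}$ be a real diagonal matrix, and set $H := H_0+V$ and $H_t := H_0 + tV$ for $t \in \mathbb{R}$. Assume that the lowest eigenvalue of $H_t$ is non-degenerate for all $t \geq 0$, and suppose that $\boldsymbol{1}$ is an eigenvector associated to the lowest eigenvalue of $H_0$. Then $H_0$ and $H$ are isospectral if and only if $V=0$.
   Context: $\boldsymbol{1} \in \mathbb{C}^n$ is the vector with all components equal to one. An eigenvalue is non-degenerate if its multiplicity is one. Two Hermitian matrices in $\mathbb{C}^{n\times n}$ are called isospectral if and only if they have the same eigenvalues, counted with multiplicities. *)

(* Defs.v *)
(* The field of complex numbers is R[i], for R : realType. *)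
From mathcomp Require Export all_boot all_order all_algebra all_reals.
From mathcomp.real_closed Require Export complex.

Set Implicit Arguments.
Unset Strict Implicit.
Unset Printing Implicit Defensive.

Import Order.TTheory GRing.Theory Num.Theory.

Local Open Scope ring_scope.
Local Open Scope complex_scope.

(* Algebraic multiplicity; for Hermitian matrices it agrees with the dimension
   of the eigenspace. It is 0 when lam is not an eigenvalue of A. *)
Definition eigen_mult (F : fieldType) (n : nat) (A : 'M[F]_n) (lam : F) : nat :=
  mup lam (char_poly A).

Definition nondegenerate_eigenvalue (F : fieldType) (n : nat) (A : 'M[F]_n)
    (lam : F) : Prop :=
  eigenvalue A lam /\ eigen_mult A lam = 1%N.

(* [eigenvalue] is defined through row vectors; row and column eigenvectors
   give the same eigenvalues, and eigenvectors are taken to be columns. *)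
Definition eigenvector (F : fieldType) (n : nat) (A : 'M[F]_n) (lam : F)
    (x : 'cV[F]_n) : Prop :=
  x != 0 /\ A *m x = lam *: x.

(* On R[i], [lam <= mu] means Im lam = Im mu and Re lam <= Re mu; it is the
   usual order on the eigenvalues of a Hermitian matrix, which are real. *)
Definition lowest_eigenvalue (R : realType) (n : nat) (A : 'M[R[i]]_n)
    (lam : R[i]) : Prop :=
  eigenvalue A lam /\ (forall mu : R[i], eigenvalue A mu -> lam <= mu).

Definition isospectral (F : fieldType) (n : nat) (A B : 'M[F]_n) : Prop :=
  forall lam : F, eigen_mult A lam = eigen_mult B lam.

Definition complex_mx (R : realType) (m n : nat) (A : 'M[R]_(m, n)) :
    'M[R[i]]_(m, n) :=
  map_mx (real_complex R) A.

(* Main.v *)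
Require Import Defs.
From mathcomp Require Import ring.

(** Isospectrality gives two facts about the perturbed
    matrix [H = H0 + V].  First, [H] and [H0] have the same characteristic
    polynomial, because a monic polynomial over an algebraically closed field is
    determined by the multiplicities of its roots ([monic_mup_inj]).  So they
    have the same trace, which says that the diagonal entries of [V] sum to
    zero, and they have the same lowest eigenvalue [lam].

    Since [V] is diagonal, that sum is also the quadratic form of [V] at the
    all-ones vector [1]: the trace and the vector [1] see the same number.  Hence
    the quadratic form of [H] at [1] equals that of [H0] at [1], namely
    [lam * n]: the vector [1] realises the minimum [lam] of the Rayleigh quotient
    of [H].  By the variational principle
    ([rayleigh_minimizer_eigenvector]), [1] is then an eigenvector of [H] for
    [lam].  As it is also one of [H0] for [lam], subtracting gives [V 1 = 0], and
    [V 1] lists the diagonal entries of [V]. *)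

Set Implicit Arguments.
Unset Strict Implicit.
Unset Printing Implicit Defensive.

Import Order.TTheory GRing.Theory Num.Theory.

Local Open Scope ring_scope.
Local Open Scope complex_scope.
Local Open Scope sesquilinear_scope.

Lemma mup_prod_XsubC (F : fieldType) (r : seq F) (x : F) :
  mup x (\prod_(z <- r) ('X - z%:P)) = count_mem x r.
Proof.
elim: r => [|a r IHr]; first by rewrite big_nil mupNroot // root1.
rewrite big_cons mupM ?polyXsubC_eq0 ?IHr //=; last first.
  by rewrite monic_neq0 // monic_prod_XsubC.
by rewrite -['X - _]expr1 mup_XsubCX; case: eqP.
Qed.

(** Two monic split polynomials with the same root multiplicities have the same
    roots up to permutation, hence are the same product of linear factors. *)
Lemma monic_mup_inj (F : closedFieldType) (p q : {poly F}) :
  p \is monic -> q \is monic -> (forall x, mup x p = mup x q) -> p = q.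
Proof.
move=> /monicP p_monic /monicP q_monic.
have [r ->] := closed_field_poly_normal p.
have [s ->] := closed_field_poly_normal q.
rewrite p_monic q_monic !scale1r => eq_mup.
apply: perm_big; apply/allP => x _ /=.
by rewrite -!mup_prod_XsubC eq_mup.
Qed.

Lemma isospectral_char_poly (F : closedFieldType) (n : nat) (A B : 'M[F]_n) :
  isospectral A B -> char_poly A = char_poly B.
Proof. by apply: monic_mup_inj; apply: char_poly_monic. Qed.

Lemma char_poly_eq_trace (R : nzRingType) (n : nat) (A B : 'M[R]_n) :
  char_poly A = char_poly B -> \tr A = \tr B.
Proof.
case: n A B => [|n] A B eqAB; first by rewrite !flatmx0.
by apply: oppr_inj; rewrite -!char_poly_trace // eqAB.
Qed.

(** The rows of the diagonalising matrix are left eigenvectors. *)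
Lemma spectral_diag_eigenvalue (C : numClosedFieldType) (n : nat) (A : 'M[C]_n)
    (i : 'I_n) :
  A \is normalmx -> eigenvalue A (spectral_diag A 0 i).
Proof.
move=> /orthomx_spectralP; set P := spectralmx A; set d := spectral_diag A.
move=> defA; have Pu : P \in unitmx by apply: spectral_unit.
apply/eigenvalueP; exists (row i P).
  rewrite {1}defA -row_mul mulmxA mulmxA mulmxV // mul1mx.
  by apply/rowP => j; rewrite mul_diag_mx !mxE.
apply: contraTneq Pu => Pi0; rewrite unitmxE (expand_det_row P i) big1 ?unitr0 //.
by move=> j _; move/rowP/(_ j): Pi0; rewrite !mxE => ->; rewrite mul0r.
Qed.

(** Equality case of the variational principle.  In an orthonormal eigenbasis,
    with coordinates [y] of [x] and eigenvalues [d], the hypothesis reads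
    [\sum_i (d i - lam) * `|y i| ^+ 2 = 0] with nonnegative terms, so [y i]
    vanishes as soon as [d i] differs from [lam]. *)
Lemma rayleigh_minimizer_eigenvector (C : numClosedFieldType) (n : nat)
    (A : 'M[C]_n) (lam : C) (x : 'cV[C]_n) :
  A \is hermsymmx -> (forall mu, eigenvalue A mu -> lam <= mu) ->
  x^t* *m A *m x = lam *: (x^t* *m x) -> A *m x = lam *: x.
Proof.
move=> /hermitian_normalmx Anormal lam_min.
have d_min i := lam_min _ (spectral_diag_eigenvalue i Anormal).
have Punitary := spectral_unitarymx A; have Pu := spectral_unit A.
move/orthomx_spectralP: Anormal d_min; rewrite invmx_unitary //.
set P := spectralmx A in Punitary Pu *; set d := spectral_diag A => defA d_min.
set y := P *m x.
have defx : x = P^t* *m y by rewrite mulmxA -invmx_unitary // mulVmx // mul1mx.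
have defxt : x^t* *m P^t* = y^t* by rewrite /y trmx_mul map_mxM.
have -> : x^t* *m A *m x = y^t* *m diag_mx d *m y.
  by rewrite {1}defA -defxt !mulmxA.
rewrite {2}defx mulmxA defxt => /matrixP/(_ 0 0) form_eq.
have term_ge0 i : true -> 0 <= (d 0 i - lam) * `|y i 0| ^+ 2.
  by rewrite mulr_ge0 ?subr_ge0 ?exprn_ge0.
have sum_eq0 : \sum_i (d 0 i - lam) * `|y i 0| ^+ 2 = 0.
  move/eqP: form_eq; rewrite -mulmxA !mxE -subr_eq0 mulr_sumr -sumrB.
  move=> /eqP sum0; rewrite -[RHS]sum0.
  apply: eq_bigr => i _; rewrite mul_diag_mx !mxE normCK; ring.
have y_eigen : diag_mx d *m y = lam *: y.
  apply/colP => i; rewrite mul_diag_mx mxE [RHS]mxE.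
  have := psumr_eq0P term_ge0 sum_eq0 (i := i) isT => /eqP.
  rewrite mulf_eq0 expf_eq0 normr_eq0 subr_eq0 /=.
  by case/orP=> /eqP ->; rewrite ?mulr0.
by rewrite {1}defA -!mulmxA -/y y_eigen -scalemxAr -defx.
Qed.

Lemma hermsymmxP (C : numClosedFieldType) (n : nat) (A : 'M[C]_n) :
  reflect (A^t* = A) (A \is hermsymmx).
Proof. by rewrite is_hermitianmxE expr0 scale1r eq_sym; apply: eqP. Qed.

Lemma complex_diag_mx_hermitian (R : realType) (n : nat) (v : 'rV[R]_n) :
  complex_mx (diag_mx v) \is hermsymmx.
Proof.
apply/hermsymmxP/matrixP => i j; rewrite !mxE eq_sym.
by have [->|_] := eqVneq i j; [apply: conjc_real | rewrite rmorph0].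
Qed.

(** For a diagonal matrix, the sum of all entries and the sum of the diagonal
    entries coincide; this links the trace to the all-ones vector. *)
Lemma diag_mx_quad_form_const1 (C : numClosedFieldType) (n : nat)
    (d : 'rV[C]_n) :
  (const_mx 1 : 'cV[C]_n)^t* *m diag_mx d *m const_mx 1 = (\tr (diag_mx d))%:M.
Proof.
apply/matrixP => i j; rewrite !ord1 -mulmxA !mxE mulr1n mxtrace_diag.
by apply: eq_bigr => k _; rewrite mul_diag_mx !mxE rmorph1 mul1r mulr1.
Qed.

Theorem theorem3 (R : realType) (n : nat) (hn : (1 <= n)%N)
    (H0 : 'M[R[i]]_n) (hH0 : H0 \is hermsymmx)
    (v : 'rV[R]_n) (V : 'M[R]_n) (hV : V = diag_mx v)
    (H : 'M[R[i]]_n) (hH : H = H0 + complex_mx V)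
    (Ht : R -> 'M[R[i]]_n)
    (hHt : forall t : R, Ht t = H0 + t%:C *: complex_mx V)
    (hnondeg : forall t : R, 0 <= t ->
       exists2 lam : R[i], lowest_eigenvalue (Ht t) lam
                         & nondegenerate_eigenvalue (Ht t) lam)
    (hone : exists2 lam : R[i], lowest_eigenvalue H0 lam
                              & eigenvector H0 lam (const_mx 1)) :
  isospectral H0 H <-> V = 0.
Proof.
split=> [iso | V0]; last by rewrite hH V0 /complex_mx map_mx0 addr0.
have eq_char := isospectral_char_poly iso.
have [lam [_ lam_min] [_ H0_one]] := hone.
set D := map_mx (real_complex R) v.
have defV : complex_mx V = diag_mx D by rewrite hV /complex_mx map_diag_mx.
have trV0 : \tr (diag_mx D) = 0.
  have := char_poly_eq_trace eq_char; rewrite hH mxtraceD defV => /eqP.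
  by rewrite -[X in X == _]addr0 (inj_eq (addrI _)) eq_sym => /eqP.
have H_herm : H \is hermsymmx.
  have V_herm := complex_diag_mx_hermitian v.
  apply/hermsymmxP; rewrite hH hV linearD /= map_mxD.
  by rewrite (hermsymmxP _ hH0) (hermsymmxP _ V_herm).
have H_min mu : eigenvalue H mu -> lam <= mu.
  by rewrite eigenvalue_root_char -eq_char -eigenvalue_root_char; apply: lam_min.
have H_one : H *m (const_mx 1 : 'cV_n) = lam *: const_mx 1.
  apply: rayleigh_minimizer_eigenvector => //.
  rewrite hH defV mulmxDr mulmxDl diag_mx_quad_form_const1 trV0.
  by rewrite raddf0 addr0 -mulmxA H0_one scalemxAr.
have V_one : diag_mx D *m (const_mx 1 : 'cV_n) = 0.
  by move: H_one; rewrite hH defV mulmxDl H0_one -[RHS]addr0 => /addrI.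
suff -> : V = diag_mx 0 by rewrite linear0.
rewrite hV; congr diag_mx; apply/rowP => i.
move/colP/(_ i): V_one; rewrite mul_diag_mx !mxE mulr1.
by move=> /eqP; rewrite fmorph_eq0 => /eqP.
Qed.
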